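(* Let $F$ be a fixed finite field and $d$ a positive integer. Let $\Gamma$ be a Boolean constraint language such that every relation $R\in\Gamma$ can be defined as the set of solutions in $\{0,1\}$ to a polynomial of degree at most $d$ over $F$ (i.e. $R$ is the set of $t\in\{0,1\}^{\mathrm{ar}(R)}$ that are roots of some polynomial in $\mathrm{ar}(R)$ variables over $F$ of degree at most $d$, where $0,1$ are identified with the zero and one of $F$). Then $\Gamma$ admits a degree-$d$ extension with a Maltsev embedding.
   Context: A Boolean constraint language is a set of finitary relations over $\{0,1\}$. Degree-$d$ extension of a tuple: for $t\in\{0,1\}^r$ and $S_1,\dots,S_l$ an enumeration of all subsets of $\{1,\dots,r\}$ of size at most $d$, the degree-$d$ extension $\check t\in\{0,1\}^l$ is given by $\check t[i]=\prod_{j\in S_i}t[j]$. Degree-$d$ extension of $\Gamma$: a Boolean language $\check\Gamma$ with a bijection $R\mapsto\check R$ from $\Gamma$ to $\check\Gamma$ such that for every $R\in\Gamma$ and every $t\in\{0,1\}^{\mathrm{ar}(R)}$, $t\in R$ if and only if $\check t\in\check R$. A Boolean language $\Delta$ admits a Maltsev embedding if there are a domain $D\supseteq\{0,1\}$, a constraint language $\hat\Delta$ over $D$, and a bijection $h:\Delta\to\hat\Delta$ with $\mathrm{ar}(h(R))=\mathrm{ar}(R)$ and $h(R)\cap\{0,1\}^{\mathrm{ar}(R)}=R$ for all $R\in\Delta$, such that every relation of $\hat\Delta$ is preserved (closed under componentwise application) by one Maltsev operation on $D$, i.e. a ternary operation $\phi$ with $\phi(x,x,y)=y$ and $\phi(x,y,y)=x$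 for all $x,y\in D$. *)

(* Defs.v *)
From mathcomp Require Import all_boot all_algebra.
From mathcomp Require Import classical_sets functions.
From mathcomp Require Import mpoly.

Set Implicit Arguments.
Unset Strict Implicit.
Unset Printing Implicit Defensive.

Import GRing.Theory.
Local Open Scope ring_scope.
Local Open Scope classical_set_scope.

Definition relation (D : Type) : Type := {n : nat & set (n.-tuple D)}.

Definition arity (D : Type) (R : relation D) : nat := tag R.

Definition tuples (D : Type) (R : relation D) : set ((arity R).-tuple D) :=
  tagged R.

Arguments tuples {D} R _.

(* Membership of an untyped sequence: it avoids transporting tuples along
   equalities between arities. *)
Definition has_seq (D : Type) (R : relation D) (s : seq D) : Prop :=
  exists2 t : (arity R).-tuple D, tuples R t & tval t = s.

Definition language (D : Type) : Type := set (relation D).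

(* [msize p] is one more than the total degree of [p], and 0 for [p = 0]. *)
Definition poly_definable (F : finFieldType) (d : nat) (R : relation bool) :
    Prop :=
  exists2 p : {mpoly F[arity R]}, (msize p <= d.+1)%N &
    forall t : (arity R).-tuple bool,
      tuples R t <-> p.@[fun i => (tnth t i)%:R] = 0.

Definition enumerates_subsets (d r : nat) (S : seq {set 'I_r}) : Prop :=
  uniq S /\ forall A : {set 'I_r}, (A \in S) = (#|A| <= d)%N.

(* The product in {0,1} is conjunction. *)
Definition extend_tuple (r : nat) (S : seq {set 'I_r}) (t : r.-tuple bool) :
    seq bool :=
  [seq \big[andb/true]_(j in A) tnth t j | A : {set 'I_r} <- S].

(* [S r] is the enumeration of the subsets of size at most [d] that is used
   for the relations of arity [r]. *)
Definition degree_extension (d : nat) (S : forall r : nat, seq {set 'I_r})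
    (Gamma Gamma' : language bool) : Prop :=
  (forall r : nat, enumerates_subsets d (S r)) /\
  exists ext : relation bool -> relation bool,
    set_bij Gamma Gamma' ext /\
    forall R : relation bool, Gamma R ->
      arity (ext R) = size (S (arity R)) /\
      forall t : (arity R).-tuple bool,
        tuples R t <-> has_seq (ext R) (extend_tuple (S (arity R)) t).

Definition maltsev (D : Type) (phi : D -> D -> D -> D) : Prop :=
  forall x y : D, phi x x y = y /\ phi x y y = x.

Definition preserves (D : Type) (phi : D -> D -> D -> D) (R : relation D) :
    Prop :=
  forall x y z : (arity R).-tuple D, tuples R x -> tuples R y -> tuples R z ->
    tuples R [tuple phi (tnth x i) (tnth y i) (tnth z i) | i < arity R].

(* The inclusion of {0,1} in the domain [D] is an injection [iota]. *)
Definition maltsev_embedding (Delta : language bool) : Prop :=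
  exists (D : Type) (iota : bool -> D) (Delta' : language D)
         (h : relation bool -> relation D),
    [/\ injective iota,
        set_bij Delta Delta' h,
        forall R : relation bool, Delta R ->
          arity (h R) = arity R /\
          forall t : (arity R).-tuple bool,
            has_seq (h R) (map iota t) <-> tuples R t
      & exists2 phi : D -> D -> D -> D, maltsev phi &
          forall R' : relation D, Delta' R' -> preserves phi R'].

(* Main.v *)
(** A polynomial of degree at most [d] is, on [{0,1}]-points, a linear function
of the degree-[d] extension of the point, because [t ^+ k = t] for [t] in
[{0,1}] and [k > 0].  Its zero set, read on extended tuples over [F], is thus
closed under the Maltsev operation [x - y + z].  The extension of [R] is the
[{0,1}]-part of the closure of the extended tuples of [R] under this operation,
and the embedding again takes the closure: both choices are canonical, and the
zero set of the polynomial shows that no tuple outside [R] is added. *)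
Require Import Defs.
From mathcomp Require Import all_boot all_algebra.
From mathcomp Require Import classical_sets functions.
From mathcomp Require Import mpoly ring.

Set Implicit Arguments.
Unset Strict Implicit.
Unset Printing Implicit Defensive.

Import GRing.Theory.
Local Open Scope ring_scope.
Local Open Scope classical_set_scope.

Lemma has_seqP (D : Type) (R : relation D) (t : (arity R).-tuple D) :
  has_seq R t <-> tuples R t.
Proof. by split=> [[u Ru /val_inj <-//]|Rt]; exists t. Qed.

(** The arities are compared separately, since empty relations of different arities contain the same
    sequences. *)
Lemma relation_ext (D : Type) (R1 R2 : relation D) :
    arity R1 = arity R2 -> (forall s, has_seq R1 s <-> has_seq R2 s) ->
  R1 = R2.
Proof.
case: R1 R2 => [n X1] [n2 X2] /= eqn; case: n2 / eqn X2 => X2 eqX.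
congr existT; apply/seteqP; split=> t.
  by move=> /(has_seqP (R := existT _ n X1))/eqX/has_seqP.
by move=> /(has_seqP (R := existT _ n X2))/eqX/has_seqP.
Qed.

Section Hull.
Variables (D : Type) (phi : D -> D -> D -> D) (n : nat).

(** The closure is taken as an intersection, so that bounding it from above takes a single invariant
    set containing [X]. *)
Definition hull (X : set (n.-tuple D)) : set (n.-tuple D) :=
  [set s | forall Y : set (n.-tuple D),
    preserves phi (existT _ n Y) -> X `<=` Y -> Y s].

Lemma sub_hull X : X `<=` hull X.
Proof. by move=> s Xs Y _ XY; apply: XY. Qed.

Lemma preserves_hull X : preserves phi (existT _ n (hull X)).
Proof.
move=> x y z Xx Xy Xz Y Yphi XY.
exact: (Yphi x y z (Xx _ Yphi XY) (Xy _ Yphi XY) (Xz _ Yphi XY)).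
Qed.

Lemma hull_sub X Y :
  preserves phi (existT _ n Y) -> X `<=` Y -> hull X `<=` Y.
Proof. by move=> Yphi XY s Xs; apply: Xs. Qed.

End Hull.

Lemma card_small_sets_lt (d m n : nat) : (0 < d)%N -> (m < n)%N ->
  (#|[set A : {set 'I_m} | (#|A| <= d)%N]%SET| <
   #|[set A : {set 'I_n} | (#|A| <= d)%N]%SET|)%N.
Proof.
move=> d_gt0 lt_mn; pose w := widen_ord (ltnW lt_mn).
have w_inj : injective w by move=> i j /(congr1 val) /= /val_inj.
rewrite -(card_imset _ (imset_inj w_inj)); apply: proper_card.
apply/properP; split.
  apply/fintype.subsetP=> _ /imsetP[A + ->]; rewrite !inE => leA.
  by rewrite card_imset.
(* The widening of indices misses the point [m]; its singleton has size 1, which is at most [d]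
   because [0 < d]. *)
exists [set Ordinal lt_mn]%SET; first by rewrite inE cards1.
apply/imsetP=> -[A _ /setP/(_ (Ordinal lt_mn))]; rewrite inE eqxx.
by move=> /esym/imsetP[i _ /(congr1 val) /= eqi]; have := ltn_ord i; rewrite -eqi ltnn.
Qed.

Lemma size_enumerates_subsets (d r : nat) (S : seq {set 'I_r}) :
  enumerates_subsets d S ->
  size S = #|[set A : {set 'I_r} | (#|A| <= d)%N]%SET|.
Proof.
case=> uS memS; rewrite -(card_uniqP uS); apply: eq_card => A.
by rewrite memS inE.
Qed.

(** This recovers the arity of a relation from that of its extension: the number of small subsets
    grows strictly with the ground set. *)
Lemma size_enumerates_subsets_inj (d m n : nat) (Sm : seq {set 'I_m})
    (Sn : seq {set 'I_n}) : (0 < d)%N ->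
  enumerates_subsets d Sm -> enumerates_subsets d Sn ->
  size Sm = size Sn -> m = n.
Proof.
move=> d_gt0 /size_enumerates_subsets-> /size_enumerates_subsets-> eqS.
by case: (ltngtP m n) => // /(card_small_sets_lt d_gt0); rewrite eqS ltnn.
Qed.

Section MaltsevExtension.
Variables (F : finFieldType) (d : nat).
Hypothesis d_gt0 : (0 < d)%N.
Variable S : forall r : nat, seq {set 'I_r}.
Hypothesis S_enum : forall r : nat, enumerates_subsets d (S r).

Definition affine_op (x y z : F) : F := x - y + z.

Definition bool_inj (b : bool) : F := b%:R.

Lemma bool_injK : cancel bool_inj (fun x => x != 0).
Proof. by case; rewrite /bool_inj ?oner_eq0 ?eqxx. Qed.

Lemma maltsev_affine_op : maltsev affine_op.
Proof. by move=> x y; rewrite /affine_op subrr add0r subrK. Qed.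

Definition embed (n : nat) (X : set (n.-tuple bool)) : set (n.-tuple F) :=
  hull affine_op [set map_tuple bool_inj s | s in X].

Definition embed_relation (R : relation bool) : relation F :=
  existT _ (arity R) (embed (@tuples _ R)).

Definition extend_relation (R : relation bool) : relation bool :=
  existT _ (size (S (arity R)))
    [set s | embed
      [set u : _.-tuple bool | exists2 t, tuples R t &
         tval u = extend_tuple (S (arity R)) t]
      (map_tuple bool_inj s)].

(** At a Boolean point a monomial equals the product over its support, which is one coordinate of
    the extended tuple. The sum stays indexed by monomials, as several of them may share a
    support. *)
Lemma meval_bool (r : nat) (p : {mpoly F[r]}) (t : r.-tuple bool) :
    (msize p <= d.+1)%N ->
  p.@[fun i => (tnth t i)%:R] =
  \sum_(m <- msupp p) p@_m *
    (map bool_inj (extend_tuple (S r) t))`_(index [set i | m i != 0%N]%SET (S r)).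
Proof.
move=> size_p; rewrite mevalE !big_seq; apply: eq_bigr => m m_p.
congr (_ * _); set A := [set i | _]%SET.
have AS : A \in S r.
  rewrite (proj2 (S_enum r)); have le_md := leq_trans (msize_mdeg_lt m_p) size_p.
  (* Each nonzero exponent adds at least 1 to the degree, so the support has at most [mdeg m]
     elements. *)
  rewrite -ltnS; apply: leq_ltn_trans le_md; rewrite mdegE -sum1_card big_mkcond.
  by apply: leq_sum => i _; rewrite inE; case: (m i).
have ltA : (index A (S r) < size (S r))%N by rewrite index_mem.
rewrite (nth_map false) ?size_map // /extend_tuple (nth_map A) //.
rewrite nth_index // /bool_inj.
rewrite (big_morph (fun b : bool => b%:R : F) (op1 := *%R) (id1 := 1)); last 2 first.
- by case; case; rewrite ?mulr1 ?mulr0.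
- by [].
rewrite [RHS]big_mkcond; apply: eq_bigr => i _; rewrite inE.
case: (m i) => [|k] /=; first by rewrite expr0.
by case: (tnth t i); rewrite ?expr1n ?expr0n.
Qed.

(** A homogeneous linear form commutes with [x - y + z], so three zero values combine to zero. *)
Lemma preserves_linear (I : eqType) (n : nat) (s : seq I) (c : I -> F)
    (f : I -> nat) :
  preserves affine_op
    (existT _ n [set x : n.-tuple F | \sum_(i <- s) c i * x`_(f i) = 0]).
Proof.
move=> x y z /= x0 y0 z0.
transitivity (\sum_(i <- s) c i * x`_(f i) - \sum_(i <- s) c i * y`_(f i)
              + \sum_(i <- s) c i * z`_(f i)); last by rewrite x0 y0 z0; ring.
rewrite -sumrB -big_split; apply: eq_bigr => i _ /=.
rewrite -mulrBr -mulrDr; congr (_ * _).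
have [lt_in|le_ni] := ltnP (f i) n.
  rewrite -[f i]/(val (Ordinal lt_in)) (nth_map (Ordinal lt_in)) ?size_enum_ord //.
  by rewrite nth_ord_enum /affine_op !(tnth_nth 0).
(* Out of range, every tuple reads the default 0, and [0 - 0 + 0 = 0]. *)
have nth0 (u : n.-tuple F) : u`_(f i) = 0 by rewrite nth_default ?size_tuple.
by rewrite !nth0 nth_default ?subr0 ?addr0 // size_map size_enum_ord.
Qed.

Lemma has_seq_extend_relation (R : relation bool) (t : (arity R).-tuple bool) :
  poly_definable F d R ->
  tuples R t <-> has_seq (extend_relation R) (extend_tuple (S (arity R)) t).
Proof.
case=> p size_p pR.
have size_t : size (extend_tuple (S (arity R)) t) == size (S (arity R)).
  by rewrite size_map.
split=> [Rt|[u Ru eq_u]].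
  exists (Tuple size_t) => //; apply: sub_hull.
  by exists (Tuple size_t) => //; exists t.
rewrite pR meval_bool // -eq_u.
(* Membership in the hull is applied to the zero set of the linear form of [p], which contains every
   extended tuple of [R]. *)
apply: (Ru _ (@preserves_linear _ _ (msupp p) (fun m => p@_m) _)).
by move=> _ [v [w Rw eq_v] <-] /=; rewrite eq_v -meval_bool // -pR.
Qed.

Lemma extend_relation_inj (R1 R2 : relation bool) :
    poly_definable F d R1 -> poly_definable F d R2 ->
  extend_relation R1 = extend_relation R2 -> R1 = R2.
Proof.
move=> p1 p2 eqR.
have /= eqn := congr1 (@arity _) eqR.
have {}eqn := size_enumerates_subsets_inj d_gt0 (S_enum _) (S_enum _) eqn.
case: R1 R2 p1 p2 eqR eqn => [n X1] [n2 X2] + + + /= eqn.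
case: n2 / eqn X2 => X2 p1 p2 eqR; congr existT.
apply/seteqP; split=> t.
  move/(has_seq_extend_relation (R := existT _ n X1) t p1); rewrite eqR.
  by move/(has_seq_extend_relation (R := existT _ n X2) t p2).
move/(has_seq_extend_relation (R := existT _ n X2) t p2); rewrite -eqR.
by move/(has_seq_extend_relation (R := existT _ n X1) t p1).
Qed.

(** The extension is the Boolean part of an invariant set, so closing it again adds no Boolean
    tuple. *)
Lemma has_seq_embed_extend (R : relation bool)
    (s : (arity (extend_relation R)).-tuple bool) :
  has_seq (embed_relation (extend_relation R)) (map bool_inj s) <->
  tuples (extend_relation R) s.
Proof.
rewrite (has_seqP (R := embed_relation _) (map_tuple bool_inj s)).
split; last by move=> Rs; apply: sub_hull; exists s.
by apply: hull_sub; [exact: preserves_hull | move=> _ [u Ru <-]].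
Qed.

(** The extension is recovered from its embedding as the part with entries 0 and 1. *)
Lemma embed_extend_inj (R1 R2 : relation bool) :
  embed_relation (extend_relation R1) = embed_relation (extend_relation R2) ->
  extend_relation R1 = extend_relation R2.
Proof.
move=> eqR; apply: relation_ext; first exact: (congr1 (@arity _) eqR).
have memE R s : has_seq (extend_relation R) s <->
    has_seq (embed_relation (extend_relation R)) (map bool_inj s).
  split=> [[u Ru <-]|]; first exact/has_seq_embed_extend.
  move=> Rs; have size_s : size s == arity (extend_relation R).
    by case: Rs => u _ eq_u; rewrite -(size_map bool_inj) -eq_u size_tuple.
  by exists (Tuple size_s) => //; apply/has_seq_embed_extend.
by move=> s; rewrite !memE eqR.
Qed.

End MaltsevExtension.

Theorem theorem24 (F : finFieldType) (d : nat) (d_gt0 : (0 < d)%N)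
    (Gamma : language bool)
    (Gamma_poly : forall R : relation bool, Gamma R -> poly_definable F d R)
    (S : forall r : nat, seq {set 'I_r})
    (S_enum : forall r : nat, enumerates_subsets d (S r)) :
  exists Gamma' : language bool,
    degree_extension d S Gamma Gamma' /\ maltsev_embedding Gamma'.
Proof.
exists (extend_relation F S @` Gamma); split.
  split=> //; exists (extend_relation F S); split.
    split=> // R1 R2 /set_mem G1 /set_mem G2.
    exact: (extend_relation_inj d_gt0 S_enum (Gamma_poly _ G1) (Gamma_poly _ G2)).
  by move=> R GR; split=> // t; apply: has_seq_extend_relation (Gamma_poly _ GR).
(* The field itself serves as the domain; taking the image as the new language makes surjectivity
   immediate. *)
exists F, (@bool_inj F), (@embed_relation F @` (extend_relation F S @` Gamma)).
exists (@embed_relation F); split.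
- exact: can_inj (@bool_injK F).
- split=> // _ _ /set_mem[R1 _ <-] /set_mem[R2 _ <-].
  exact: embed_extend_inj.
- by move=> _ [R _ <-]; split=> // s; exact: has_seq_embed_extend.
- exists (@affine_op F); first exact: maltsev_affine_op.
  by move=> _ [R _ <-]; exact: preserves_hull.
Qed.
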